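(* Let $q$ be a prime power. A regular spread of $\mathsf{W}_3(q)$ with a line removed is a neighbour-transitive code of size $q^2$.
   Context: $\mathsf{W}_3(q)$: let $V=\mathbb{F}_q^4$ be equipped with a non-degenerate symplectic bilinear form $f$. Points are the $1$-dimensional subspaces of $V$, lines are the totally isotropic $2$-dimensional subspaces of $V$, incidence is symmetrised containment. Its point-line incidence graph $\varGamma$ has all points and lines as vertices, with adjacency given by incidence. A spread of $\mathsf{W}_3(q)$ is a set of lines such that each point is incident with exactly one of them. It is regular (Desarguesian) if it is obtained by field reduction, i.e. there is a $2$-dimensional $\mathbb{F}_{q^2}$-vector space structure on $V$ extending its $\mathbb{F}_q$-structure such that the spread is the set of all $1$-dimensional $\mathbb{F}_{q^2}$-subspaces of $V$. A code $C$ is a subset of the vertex set of $\varGamma$; $C_1$ is the set of vertices not in $C$ that are adjacent to some element of $C$; $\operatorname{Aut}(C)$ is the setwise stabiliser of $C$ in $\operatorname{Aut}(\varGamma)$; $C$ is neighbour-transitive if $\operatorname{Aut}(C)$ acts transitively on each of $C$ and $C_1$. *)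

(* Defs.v *)
From HB Require Import structures.
From mathcomp Require Import all_boot all_order all_fingroup all_algebra all_field.

Set Implicit Arguments.
Unset Strict Implicit.
Unset Printing Implicit Defensive.

Import GRing.Theory VectorInternalTheory.
Local Open Scope ring_scope.

(* Subspaces of a finite-dimensional space over a finite field form a finite
   type (they are encoded by their canonical generating matrices).            *)
HB.instance Definition _ (F : finFieldType) (vT : vectType F) :=
  [Countable of {vspace vT} by <:].
HB.instance Definition _ (F : finFieldType) (vT : vectType F) :=
  [Finite of {vspace vT} by <:].

Section Codes.
Variables (T : finType) (e : rel T).
Implicit Types C : {set T}.

Definition graph_aut : {set {perm T}} :=
  [set g : {perm T} | [forall x, forall y, e (g x) (g y) == e x y]].

Fact graph_aut_group_set : group_set graph_aut.
Proof.
apply/group_setP; split.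
  by rewrite inE; apply/forallP=> x; apply/forallP=> y; rewrite !perm1.
move=> g h; rewrite !inE => /forallP gP /forallP hP.
apply/forallP=> x; apply/forallP=> y; rewrite !permM.
by rewrite (eqP (forallP (hP _) _)) (eqP (forallP (gP _) _)).
Qed.

Canonical graph_aut_group := Group graph_aut_group_set.

Definition code_neighbours C : {set T} :=
  [set v | (v \notin C) && [exists u in C, e u v]].

Definition code_aut C : {set {perm T}} := 'N_(graph_aut)(C | 'P)%g.

Definition neighbour_transitive C :=
  [transitive code_aut C, on C | 'P] /\
  [transitive code_aut C, on code_neighbours C | 'P].

End Codes.

(* [W_3(q)] is the case where [f] satisfies [is_psymplectic f], i.e. [f] is
   non-degenerate and alternating (in characteristic 2, where skew-symmetric
   forms need not be alternating, [is_psymplectic] adds [f u u = 0]).         *)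
Section W3.
Variables (F : finFieldType) (f : {skew_symmetric 'rV[F]_4}).
Local Notation V := 'rV[F]_4.

Definition W3_point := {U : {vspace V} | \dim U == 1%N}.

(* [U <= orthov f U] says that [f] vanishes on [U * U]. *)
Definition W3_line :=
  {U : {vspace V} | (\dim U == 2%N) && (U <= orthov f U)%VS}.

Definition W3_incident (p : W3_point) (l : W3_line) : bool :=
  (val p <= val l)%VS.

Definition W3_vertex : finType := (W3_point + W3_line)%type.

Definition W3_graph : rel W3_vertex := fun x y =>
  match x, y with
  | inl p, inr l | inr l, inl p => W3_incident p l
  | _, _ => false
  end.

Definition is_spread (S : {set W3_line}) :=
  forall p : W3_point, #|[set l in S | W3_incident p l]| = 1%N.

(* Field reduction: [L] is a quadratic extension of [F], and the additive
   bijection [phi] transports to [V] the scalar multiplication of a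
   2-dimensional [L]-space [W]; the third conjunct says that the resulting
   [L]-structure on [V] extends its [F]-structure.  The last one says that [S]
   is the set of images of all 1-dimensional [L]-subspaces of [W].            *)
Definition is_desarguesian (S : {set W3_line}) :=
  exists (L : fieldExtType F) (W : vectType L) (phi : {additive W -> V}),
    [/\ \dim {:L} = 2%N /\ \dim {:W} = 2%N,
        bijective phi,
        forall (a : F) (w : W), phi (a%:A *: w) = a *: phi w
      & forall U : {vspace V},
          (exists2 l, l \in S & val l = U) <->
          (exists2 D : {vspace W}, \dim D = 1%N
            & forall w, (phi w \in U) = (w \in D))].

Definition is_regular_spread (S : {set W3_line}) :=
  is_spread S /\ is_desarguesian S.

End W3.

(* Main.v *)
(** Every L-line of V (L the quadratic extension of F) lies in the spread, hence
    is totally isotropic: f (a w) (b w) = 0 for all a, b in L.  Polarising, the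
    scalars of L are self-adjoint for f, so f (a e + b u) (c e + d u) depends on
    a, b, c, d only through a d - b c, and SL_2(L) acts by isometries preserving
    the spread.  The stabiliser in SL_2(L) of the L-line l is already transitive
    on the vectors outside l, hence on the points off l, which are the
    neighbours of the code, and therefore also on the remaining spread lines. *)
Require Import Defs.
From HB Require Import structures.
From mathcomp Require Import all_boot all_order all_fingroup all_algebra all_field.
From mathcomp Require Import ring.

Set Implicit Arguments.
Unset Strict Implicit.
Unset Printing Implicit Defensive.

Import GRing.Theory.

(** * Transitive actions and automorphisms of codes *)

Lemma atrans_intro (aT : finGroupType) (D : {group aT}) (rT : finType)
    (to : action D rT) (A : {group aT}) (N : {set rT}) :
    N != set0 -> {in A & N, forall a x, to x a \in N} ->
    {in N &, forall x y, exists2 a, a \in A & to x a = y} ->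
  [transitive A, on N | to].
Proof.
case/set0Pn=> x Nx closedN transN; apply/imsetP; exists x => //.
apply/setP=> y; apply/idP/imsetP=> [Ny | [a Aa ->]]; last exact: closedN.
by have [a Aa <-] := transN x y Nx Ny; exists a.
Qed.

Section CodeAutomorphisms.
Variables (T : finType) (e : rel T).
Implicit Types (C : {set T}) (s : {perm T}).

(** By finiteness, an injective map sending [C] into itself sends it onto itself, so one inclusion
    is enough for the setwise stabiliser. *)
Lemma mem_code_aut C s :
    s \in graph_aut e -> {in C, forall x, s x \in C} -> s \in code_aut e C.
Proof.
move=> auts sC; rewrite in_setI auts; apply/astabsP=> x.
have sCC : s @: C = C.
  apply/eqP; rewrite eqEcard card_imset ?leqnn ?andbT; last exact: perm_inj.
  by apply/subsetP=> _ /imsetP[y Cy ->]; apply: sC.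
by rewrite /= apermE -{1}sCC mem_imset //; apply: perm_inj.
Qed.

Lemma code_autP C s : s \in code_aut e C ->
  (forall x y, e (s x) (s y) = e x y) /\ (forall x, (s x \in C) = (x \in C)).
Proof.
case/setIP=> + nCs; rewrite inE => /forallP auts; split=> [x y|x].
  exact/eqP/(forallP (auts x)).
by have := astabs_act x nCs; rewrite /= apermE.
Qed.

Lemma code_neighbours_act C s v :
  s \in code_aut e C -> v \in code_neighbours e C -> s v \in code_neighbours e C.
Proof.
case/code_autP=> es Cs; rewrite !inE Cs => /andP[-> /exists_inP[u Cu euv]] /=.
by apply/exists_inP; exists (s u); rewrite ?Cs ?es.
Qed.

End CodeAutomorphisms.

(** * Linear isometries as automorphisms of the incidence graph *)

Section LinearIsometries.
Local Open Scope ring_scope.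
Variables (F : finFieldType) (f : {skew_symmetric 'rV[F]_4}).
Local Notation V := 'rV[F]_4.
Variable g : 'End(V).
Hypotheses (g_inj : lker g == 0%VS) (g_iso : forall u v, f (g u) (g v) = f u v).

Fact W3_point_image_subproof (p : W3_point F) : \dim (g @: val p) == 1%N.
Proof. by rewrite limg_dim_eq ?(eqP g_inj) ?capv0 //; apply: valP p. Qed.

Fact W3_line_image_subproof (l : W3_line f) :
  (\dim (g @: val l) == 2%N) && (g @: val l <= orthov f (g @: val l))%VS.
Proof.
have /andP[dl /orthovP isol] := valP l.
rewrite limg_dim_eq ?(eqP g_inj) ?capv0 // dl /=.
apply/orthovP=> _ _ /memv_imgP[u lu ->] /memv_imgP[v lv ->].
by rewrite g_iso isol.
Qed.

Definition W3_vertex_image (x : W3_vertex f) : W3_vertex f :=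
  match x with
  | inl p => inl (exist _ (g @: val p)%VS (W3_point_image_subproof p))
  | inr l => inr (exist _ (g @: val l)%VS (W3_line_image_subproof l))
  end.

Lemma limg_inj : injective (fun U => g @: U)%VS.
Proof.
by move=> U U' /eqP; rewrite eqEsubv !limg_ker0 // -eqEsubv => /eqP.
Qed.

Lemma W3_vertex_image_inj : injective W3_vertex_image.
Proof.
case=> [p|l] [p'|l'] //= [/limg_inj eq_val]; congr (_ _); exact: val_inj.
Qed.

Definition W3_perm : {perm W3_vertex f} := perm W3_vertex_image_inj.

Lemma W3_perm_graph_aut : W3_perm \in graph_aut (@W3_graph F f).
Proof.
rewrite inE; apply/forallP=> x; apply/forallP=> y; rewrite !permE.
by case: x y => [p|l] [p'|l'] //=; rewrite /W3_incident /= limg_ker0.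
Qed.

End LinearIsometries.

(** * Isometries that are linear over the quadratic extension *)

Section Desarguesian.
Local Open Scope ring_scope.
Variables (F : finFieldType) (f : {skew_symmetric 'rV[F]_4}).
Local Notation V := 'rV[F]_4.
Variables (L : fieldExtType F) (W : vectType L) (phi : {additive W -> V}).
Hypothesis (dimW : \dim {:W} = 2%N).
Hypothesis phi_bij : bijective phi.
Hypothesis phiZ : forall (a : F) (w : W), phi (a%:A *: w) = a *: phi w.

Local Notation B w w' := (f (phi w) (phi w')).
Hypothesis iso : forall (w : W) (a b : L), B (a *: w) (b *: w) = 0.

Let skew w w' : B w w' = - B w' w.
Proof. by rewrite hermC /= expr1 mulN1r. Qed.

Let BDl w1 w2 w : B (w1 + w2) w = B w1 w + B w2 w.
Proof. by rewrite raddfD linearDl. Qed.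

Let BDr w1 w2 w : B w (w1 + w2) = B w w1 + B w w2.
Proof. by rewrite raddfD linearDr. Qed.

(** Expanding [B (w + w') (a *: (w + w')) = 0] leaves two cross terms, and skew-symmetry turns their
    cancellation into self-adjointness. *)
Lemma scale_selfadjoint (a : L) w w' : B (a *: w) w' = B w (a *: w').
Proof.
have isoa x : B x (a *: x) = 0 by rewrite -{1}[x]scale1r iso.
have := isoa (w + w'); rewrite scalerDr !(BDl, BDr) !isoa add0r addr0.
by move/eqP; rewrite addr_eq0 -skew => /eqP.
Qed.

(** The terms in [(e, e)] and [(u, u)] vanish by [iso]; self-adjointness moves all scalars of the
    cross terms onto [e]. *)
Lemma form_det (a b c d : L) e u :
  B (a *: e + b *: u) (c *: e + d *: u) = B ((a * d - b * c) *: e) u.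
Proof.
rewrite !(BDl, BDr) !iso add0r addr0 -scale_selfadjoint scalerA.
rewrite [B (b *: u) _]skew -scale_selfadjoint scalerA.
by rewrite scalerBl raddfB linearBl mulrC /=.
Qed.

(** With [v' = x *: e + y *: v], the [L]-linear map sending [e] to [y^-1 *: e] and [v] to [v'] is
    unimodular, hence an isometry by [form_det]. *)
Lemma isometry_exists (e v v' : W) : nondegenerate f -> e != 0 ->
    v \notin <[e]>%VS -> v' \notin <[e]>%VS ->
  exists2 g : 'End(V),
    [/\ lker g == 0%VS & forall x y, f (g x) (g y) = f x y]
    & exists2 G : {linear W -> W}, (forall w, g (phi w) = phi (G w))
    & G v = v' /\ exists c, G e = c *: e.
Proof.
move=> nondeg nz_e v'e v''e.
(* In this order, coordinate 0 is along [v] and coordinate 1 along [e]. *)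
pose X := [tuple v; e].
have freeX : free X by rewrite /= free_cons seq1_free span_seq1 v'e.
have basisX : basis_of fullv X by rewrite basisEfree freeX subvf dimW.
have coordE w : w = coord X 1 w *: e + coord X 0 w *: v.
  rewrite {1}(coord_basis basisX (memvf w)) big_ord_recl big_ord1 addrC.
  by congr (_ *: _ + _); congr (coord _ _ _); apply: val_inj.
have coord0v : coord X 0 v = 1 by rewrite (coord_free 0 0 freeX).
have coord1v : coord X 1 v = 0 by rewrite (coord_free 0 1 freeX).
have coord0e : coord X 0 e = 0 by rewrite (coord_free 1 0 freeX).
have coord1e : coord X 1 e = 1 by rewrite (coord_free 1 1 freeX).
have := coordE v'; set x := coord X 1 v'; set y := coord X 0 v' => Dv'.
have nz_y : y != 0.
  apply: contraNneq v''e => y0; rewrite Dv' y0 scale0r addr0.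
  by rewrite memvZ ?memv_line.
(* In the basis (e, v), G has determinant y^-1 * y = 1. *)
pose G w := (coord X 1 w / y + coord X 0 w * x) *: e + (coord X 0 w * y) *: v.
have G_lin : linear G.
  move=> a w1 w2.
  have coordP i : coord X i (a *: w1 + w2) = a * coord X i w1 + coord X i w2.
    by rewrite linearP.
  rewrite /G !coordP scalerDr !scalerA addrACA -!scalerDl.
  by congr (_ *: _ + _ *: _); ring.
pose GL : {linear W -> W} := HB.pack G (GRing.isLinear.Build _ _ _ _ G G_lin).
have [psi phiK psiK] := phi_bij.
have psi_lin (a : F) x1 x2 : psi (a *: x1 + x2) = a%:A *: psi x1 + psi x2.
  by apply: (can_inj phiK); rewrite psiK raddfD phiZ !psiK.
pose g0 (x : V) : V := phi (G (psi x)).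
have g0_lin : linear g0.
  by move=> a x1 x2; rewrite /g0 psi_lin G_lin raddfD phiZ.
pose g1 : {linear V -> V} := HB.pack g0 (GRing.isLinear.Build _ _ _ _ g0 g0_lin).
have g1E w : linfun g1 (phi w) = phi (G w) by rewrite lfunE /= /g0 phiK.
have g_iso x1 x2 : f (linfun g1 x1) (linfun g1 x2) = f x1 x2.
  rewrite -[x1]psiK -[x2]psiK !g1E [in RHS](coordE (psi x1)).
  rewrite [in RHS](coordE (psi x2)) /G !form_det.
  by congr (f (phi (_ *: _)) _); field.
(* Injectivity: a kernel vector is orthogonal to all of [V], so it is zero by non-degeneracy. *)
exists (linfun g1); first split=> //.
  rewrite -subv0; apply/subvP=> x1; rewrite memv_ker => /eqP gx1.
  rewrite -(eqP nondeg); apply/mem_orthovP=> x2 _.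
  by rewrite -g_iso gx1 linear0l.
exists GL => //=; split.
  by rewrite /G coord0v coord1v mul0r add0r !mul1r -Dv'.
by exists y^-1; rewrite /G coord0e coord1e !mul0r addr0 mul1r scale0r addr0.
Qed.

End Desarguesian.

(** * Spreads in terms of nonzero vectors, and their size *)

Section Spreads.
Local Open Scope ring_scope.
Variables (F : finFieldType) (f : {skew_symmetric 'rV[F]_4}).
Local Notation V := 'rV[F]_4.
Variable S : {set W3_line f}.
Hypothesis spreadS : is_spread S.

Fact W3_span_subproof (v : V) : v != 0 -> \dim <[v]>%VS == 1%N.
Proof. by rewrite dim_vline => ->. Qed.

Definition W3_span v (nz_v : v != 0) : W3_point F :=
  exist _ <[v]>%VS (W3_span_subproof nz_v).

Lemma W3_spanP (p : W3_point F) : exists2 v : V, v != 0 & val p = <[v]>%VS.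
Proof.
have /eqP dp := valP p; exists (vpick (val p)).
  by rewrite vpick0 -dimv_eq0 dp.
apply/esym/eqP; rewrite eqEdim -memvE memv_pick dp dim_vline.
by rewrite vpick0 -dimv_eq0 dp.
Qed.

Lemma W3_lineP (l : W3_line f) : exists2 v : V, v != 0 & v \in val l.
Proof.
have /andP[/eqP dl _] := valP l; exists (vpick (val l)); last exact: memv_pick.
by rewrite vpick0 -dimv_eq0 dl.
Qed.

Lemma spread_card_mem v : v != 0 -> #|[set m in S | v \in val m]| = 1%N.
Proof.
move=> nz_v; apply: etrans (spreadS (W3_span nz_v)).
by apply: eq_card => m; rewrite !inE.
Qed.

Lemma spread_exists v : v != 0 -> exists2 m, m \in S & v \in val m.
Proof.
move/spread_card_mem/eqP/cards1P=> [m /setP/(_ m)].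
by rewrite !inE eqxx => /andP[Sm mv]; exists m.
Qed.

Lemma spread_unique v m m' : v != 0 -> m \in S -> m' \in S ->
  v \in val m -> v \in val m' -> m = m'.
Proof.
move=> /spread_card_mem/eqP/cards1P[m0 /setP Dm0] Sm Sm' mv m'v.
have := Dm0 m; have := Dm0 m'.
by rewrite !inE Sm Sm' mv m'v => /esym/eqP-> /esym/eqP->.
Qed.

(* Double counting of the pairs (v, m) with v a nonzero vector of m in S. *)
Lemma card_spread : #|S| = (#|F| ^ 2).+1.
Proof.
have q_gt1 : (1 < #|F|)%N by apply: finNzRing_gt1.
have countE : (\sum_(m in S) #|[set v in val m | v != 0%R]|
             = \sum_(v : V | v != 0%R) #|[set m in S | v \in val m]|)%N.
  transitivity (\sum_(m in S) \sum_(v : V | (v \in val m) && (v != 0%R)) 1)%N.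
    by apply: eq_bigr => m _; rewrite -sum1_card; apply: eq_bigl => v; rewrite !inE.
  rewrite (exchange_big_dep (fun v : V => v != 0)) /=; last by move=> m v _ /andP[].
  apply: eq_bigr => v nz_v; rewrite -sum1_card; apply: eq_bigl => m.
  by rewrite !inE nz_v andbT.
have nzE (U : {vspace V}) : #|[set v in U | v != 0]| = (#|F| ^ \dim U).-1.
  rewrite -card_vspace (cardD1 0 U) mem0v /=.
  by apply: eq_card => v; rewrite !inE andbC.
have lhsE : (\sum_(m in S) #|[set v in val m | v != 0%R]| = #|S| * (#|F| ^ 2).-1)%N.
  rewrite -sum_nat_const; apply: eq_bigr => m _; rewrite nzE.
  by have /andP[/eqP-> _] := valP m.
have rhsE : (\sum_(v : V | v != 0%R) #|[set m in S | v \in val m]| = (#|F| ^ 4).-1)%N.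
  rewrite (eq_bigr (fun=> 1%N)); last exact: spread_card_mem.
  have := nzE fullv; rewrite dimvf /dim /= => <-; rewrite sum1dep_card.
  by apply: eq_card => v; rewrite !inE memvf.
have fourE : ((#|F| ^ 4).-1 = (#|F| ^ 2).+1 * (#|F| ^ 2).-1)%N.
  by have := subn_sqr (#|F| ^ 2) 1; rewrite exp1n -expnM !subn1 addn1 mulnC.
(* The common factor q^2 - 1 can be cancelled because q > 1. *)
apply/eqP; rewrite -(eqn_pmul2r (m := (#|F| ^ 2).-1)).
  by rewrite -lhsE countE rhsE fourE.
by rewrite -subn1 subn_gt0 -{1}(exp1n 2) ltn_exp2r.
Qed.

End Spreads.

(** * Isometries stabilising a regular spread and one of its lines *)

Section RegularSpread.
Local Open Scope ring_scope.
Variables (F : finFieldType) (f : {skew_symmetric 'rV[F]_4}).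
Local Notation V := 'rV[F]_4.
Variable S : {set W3_line f}.
Hypotheses (nondeg : nondegenerate f) (regS : is_regular_spread S).

(** Apply [isometry_exists] with [phi e] a nonzero vector of [l]. The resulting map is [L]-linear,
    so it permutes the [L]-lines, which are the elements of [S]. *)
Lemma regular_spread_isometry (l : W3_line f) (v v' : V) :
    l \in S -> v \notin val l -> v' \notin val l ->
  exists2 g : 'End(V),
    [/\ lker g == 0%VS & forall x y, f (g x) (g y) = f x y]
    & [/\ g v = v', (g @: val l)%VS = val l
        & {in S, forall m, exists2 m', m' \in S & (g @: val m)%VS = val m'}].
Proof.
have [spreadS [L [W [phi [[_ dimW] phi_bij phiZ SE]]]]] := regS.
move=> Sl lv lv'; have [psi phiK psiK] := phi_bij.
have phi_eq0 w : (phi w == 0) = (w == 0).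
  by rewrite -(raddf0 phi) (can_eq phiK).
(* A spread line corresponds to a 1-dimensional [D], which any nonzero [w] in it spans. *)
have mem_line m w x : m \in S -> w != 0 -> phi w \in val m ->
    (phi x \in val m) = (x \in <[w]>%VS).
  move=> Sm nz_w mw; have [D dimD memD] := (SE (val m)).1 (ex_intro2 _ _ m Sm erefl).
  rewrite memD; suff -> : D = <[w]>%VS by []; apply/esym/eqP.
  by rewrite eqEdim -memvE -memD mw dimD dim_vline nz_w.
(* Both multiples of [w] lie in the spread line through [phi w], which is totally isotropic. *)
have iso w (a b : L) : f (phi (a *: w)) (phi (b *: w)) = 0.
  have [->|nz_w] := eqVneq w 0; first by rewrite !scaler0 raddf0 linear0l.
  have [|m Sm mw] := spread_exists spreadS (v := phi w); first by rewrite phi_eq0.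
  have /andP[_ /orthovP->//] := valP m;
    by rewrite (mem_line m w) // memvZ ?memv_line.
have [u nz_u lu] := W3_lineP l.
have [e Du]: exists e, u = phi e by exists (psi u).
rewrite {u}Du phi_eq0 in nz_u lu.
have [g [g_inj g_iso] [G gE [Gv [c Ge]]]] :
    exists2 g : 'End(V), [/\ lker g == 0%VS & forall x y, f (g x) (g y) = f x y]
    & exists2 G : {linear W -> W}, (forall w, g (phi w) = phi (G w))
    & G (psi v) = psi v' /\ exists c, G e = c *: e.
  by apply: isometry_exists => //; rewrite -(mem_line l e) ?psiK.
have g_eq0 x : (g x == 0) = (x == 0).
  by rewrite -[in LHS](linear0 g) (inj_eq (lker0P g_inj)).
(* An [L]-line is determined by one nonzero vector, so it suffices to follow the image of a single
   vector of [m]. *)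
have g_line m m' w : m \in S -> m' \in S -> w != 0 -> phi w \in val m ->
    g (phi w) \in val m' -> (g @: val m)%VS = val m'.
  move=> Sm Sm' nz_w mw m'gw; apply/eqP; rewrite eqEdim.
  have /andP[/eqP dm _] := valP m; have /andP[/eqP dm' _] := valP m'.
  rewrite limg_dim_eq ?(eqP g_inj) ?capv0 // dm dm' leqnn andbT.
  apply/subvP=> _ /memv_imgP[x mx ->]; rewrite -[x]psiK gE.
  rewrite -[x]psiK (mem_line m w) // in mx; have /vlineP[a ->] := mx.
  rewrite (mem_line m' (G w)) //; last by rewrite -gE.
    by rewrite linearZ memvZ ?memv_line.
  by rewrite -phi_eq0 -gE g_eq0 phi_eq0.
exists g => //; split.
- by rewrite -[v]psiK gE Gv psiK.
- apply: (g_line l l e) => //.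
  by rewrite gE Ge (mem_line l e) // memvZ ?memv_line.
move=> m Sm; have [x nz_x mx] := W3_lineP m.
have [|m' Sm' m'gx] := spread_exists spreadS (v := g x); first by rewrite g_eq0.
exists m' => //; apply: (g_line m m' (psi x)); rewrite ?psiK //.
by rewrite -phi_eq0 psiK.
Qed.

End RegularSpread.

(** * Transitivity on the code and on its neighbours *)

Theorem lemma4p3 (q : nat) (F : finFieldType) (hq : #|F| = q)
    (f : {skew_symmetric 'rV[F]_4}%R) (hf : is_psymplectic f)
    (S : {set W3_line f}) (hS : is_regular_spread S)
    (l : W3_line f) (hl : l \in S) :
  let C : {set W3_vertex f} := [set inr m | m in S :\ l] in
  neighbour_transitive (@W3_graph F f) C /\ #|C| = q ^ 2.
Proof.
move=> C; have [nondeg _ _] := hf; have [spreadS _] := hS.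
have memC m : (inr m \in C) = (m != l) && (m \in S).
  by rewrite mem_imset ?inE // => ? ? [].
have cardC : #|C| = (q ^ 2)%N.
  rewrite card_imset; last by move=> ? ? [].
  by apply: succn_inj; rewrite -hq -(card_spread spreadS) (cardsD1 l S) hl.
(* A point off [l] lies on a spread line other than [l], hence in the code; a point on [l] lies on
   no other spread line. *)
have pointsC p : inl p \in code_neighbours (@W3_graph F f) C = ~~ W3_incident p l.
  rewrite inE; have -> : (inl p \in C) = false by apply/imsetP=> -[].
  have [v nz_v Dp] := W3_spanP p; rewrite /W3_incident Dp -memvE /=.
  apply/exists_inP/idP=> [[_ /imsetP[m /setD1P[m'l Sm] ->]] /= | lv].
    rewrite /W3_incident Dp -memvE => mv; apply: contraNN m'l => lv.
    by rewrite (spread_unique spreadS nz_v Sm hl mv lv).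
  have [m Sm mv] := spread_exists spreadS nz_v.
  exists (inr m); last by rewrite /= /W3_incident Dp -memvE.
  by rewrite memC Sm andbT; apply: contraNneq lv => <-.
have linesC m : inr m \in code_neighbours (@W3_graph F f) C = false.
  rewrite inE; apply/andP=> -[_ /exists_inP[_ /imsetP[m' _ ->]]] //.
have movesC p p' : ~~ W3_incident p l -> ~~ W3_incident p' l ->
  exists2 s, s \in code_aut (@W3_graph F f) C & s (inl p) = inl p'.
  have [v nz_v Dp] := W3_spanP p; have [v' nz_v' Dp'] := W3_spanP p'.
  rewrite /W3_incident Dp Dp' -!memvE => lv lv'.
  have [g [g_inj g_iso] [gv gl gS]] := regular_spread_isometry nondeg hS hl lv lv'.
  exists (W3_perm g_inj g_iso); last first.
    by rewrite permE; congr inl; apply: val_inj; rewrite /= Dp Dp' limg_line gv.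
  apply: mem_code_aut; first exact: W3_perm_graph_aut.
  move=> _ /imsetP[m /setD1P[m'l Sm] ->]; rewrite permE memC.
  have [m' Sm' gm] := gS m Sm; apply/andP; split.
    apply: contraNneq m'l => /(congr1 val) /= Dgm.
    by apply/eqP/val_inj/(limg_inj g_inj); rewrite Dgm gl.
  by rewrite (_ : exist _ _ _ = m') //; apply: val_inj.
(* Distinct spread lines share no point, so any point of [m] will do. *)
have line_point m : m != l -> m \in S ->
    exists2 p, ~~ W3_incident p l & W3_incident p m.
  move=> m'l Sm; have [v nz_v mv] := W3_lineP m.
  exists (W3_span nz_v); rewrite /W3_incident -memvE //.
  by apply: contraNN m'l => lv; rewrite (spread_unique spreadS nz_v Sm hl mv lv).
have [m0 m0'l Sm0] : exists2 m, m != l & m \in S.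
  have: C != set0 by rewrite -card_gt0 cardC expn_gt0 -hq ltnW // finNzRing_gt1.
  by case/set0Pn=> _ /imsetP[m /setD1P[m'l Sm] _]; exists m.
have [p0 lp0 mp0] := line_point m0 m0'l Sm0.
split=> //; split; apply: atrans_intro.
- by apply/set0Pn; exists (inr m0); rewrite memC m0'l.
- by move=> s x /code_autP[_ Cs] Cx; rewrite /= apermE Cs.
(* Choose [p] on [m] and [p'] on [m'], and move [p] to [p']. The image of [m] is then a spread line
   through [p'], and [m'] is the only one. *)
- move=> _ _ /imsetP[m /setD1P[m'l Sm] ->] /imsetP[m' /setD1P[m''l Sm'] ->].
  have [p lp mp] := line_point m m'l Sm; have [p' lp' mp'] := line_point m' m''l Sm'.
  have [s Cs sp] := movesC p p' lp lp'; exists s => //; rewrite /= apermE.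
  have [es sC] := code_autP Cs.
  have := sC (inr m); rewrite memC m'l Sm => /imsetP[m1 /setD1P[_ Sm1] Dm1].
  have := es (inl p) (inr m); rewrite sp Dm1 /= mp => m1p'.
  have [v nz_v Dp'] := W3_spanP p'; rewrite /W3_incident Dp' -!memvE in mp' m1p'.
  by rewrite (spread_unique spreadS nz_v Sm1 Sm' m1p' mp').
- by apply/set0Pn; exists (inl p0); rewrite pointsC.
- by move=> s x Cs Nx; rewrite /= apermE code_neighbours_act.
move=> x y; case: x => [p|m]; case: y => [p'|m'];
  rewrite ?linesC ?pointsC // => lp lp'.
by have [s Cs sp] := movesC p p' lp lp'; exists s; rewrite //= apermE.
Qed.
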